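(* Let $\mathcal W$ be a non-P-point in standard position on $\omega^2$. Assume $\mathcal W$ has the three-functions property and that $\pi_1$ is a conservative map on $\mathcal W$. Then $\mathcal W$ is $(n,T(n))$-weakly Ramsey for every $n\ge1$.
   Context: Ultrafilters are nonprincipal. A non-P-point in standard position is an ultrafilter $\mathcal W$ on $\omega^2$ such that the first projection $\pi_1$ is neither finite-to-one nor constant on any set in $\mathcal W$. Three-functions property: for every function $f$ on $\omega^2$ there is $H\in\mathcal W$ with $f\restriction H$ constant, one-to-one, or equal to $g\circ\pi_1\restriction H$ with $g$ one-to-one. $(n,t)$-weakly Ramsey: for every partition of $[\omega^2]^n$ into finitely many pieces some $H\in\mathcal W$ has $[H]^n$ meeting at most $t$ pieces. $T(n)$ is the number of $n$-types, where an $n$-type is a linear pre-order of formal symbols $x_1,\dots,x_n,y_1,\dots,y_n$ with $y_1<\dots<y_n$ strictly, each $x_i<y_i$ strictly, and any two distinct equivalent symbols both $x$'s. Conservativity: the language of full arithmetic has a function or relation symbol for every finitary function and relation on $\omega$; $\mathfrak N$ is the standard model on $\omega$. For an ultrafilter $\mathcal D$ on a countable set $S$, $\mathcal D\text{-prod}\,\mathfrak N$ is the ultrapower of $\mathfrak N$ by $\mathcal D$ (functions $S\to\omega$ modulo $\mathcal D$). For $f$ with domain $S$, $f(\mathcal D)=\{B:f^{-1}(B)\in\mathcal D\}$ and $f_*:f(\mathcal D)\text{-prod}\,\mathfrak N\to\mathcal D\text{-prod}\,\mathfrak N$, $[g]\mapsto[g\circ f]$, is an elementary embedding. An elementary extension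 $\mathfrak B$ of $\mathfrak A$ is conservative if for every subset $X$ of $\mathfrak B$ definable with parameters in $\mathfrak B$, $X\cap|\mathfrak A|$ is definable with parameters in $\mathfrak A$. $f$ is a conservative map on $\mathcal D$ if $\mathcal D\text{-prod}\,\mathfrak N$ is a conservative extension of the image of $f_*$. *)

(* Defs.v *)
From mathcomp Require Import all_boot.
Set Implicit Arguments. Unset Strict Implicit. Unset Printing Implicit Defensive.

Definition is_ultrafilter (S : Type) (D : (S -> Prop) -> Prop) : Prop :=
  [/\ ~ D (fun _ => False),
      (forall A B : S -> Prop, D A -> (forall x, A x -> B x) -> D B),
      (forall A B : S -> Prop, D A -> D B -> D (fun x => A x /\ B x))
    & (forall A : S -> Prop, D A \/ D (fun x => ~ A x))].

Definition nonprincipal (S : Type) (D : (S -> Prop) -> Prop) : Prop :=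
  forall a : S, ~ D (fun x => x = a).

Definition pi1 : nat * nat -> nat := fst.

Definition pi1_constant_on (H : nat * nat -> Prop) : Prop :=
  exists m, forall x, H x -> pi1 x = m.

Definition pi1_finite_to_one_on (H : nat * nat -> Prop) : Prop :=
  forall m, exists l : seq (nat * nat), forall x, H x -> pi1 x = m -> x \in l.

(** non-P-point in standard position (ultrafilter + nonprincipal assumed separately) *)
Definition non_P_point_std (W : (nat * nat -> Prop) -> Prop) : Prop :=
  forall H, W H -> ~ pi1_constant_on H /\ ~ pi1_finite_to_one_on H.

Definition three_functions_property (W : (nat * nat -> Prop) -> Prop) : Prop :=
  forall f : nat * nat -> nat, exists H, W H /\
    ( (exists c, forall x, H x -> f x = c)
    \/ (forall x y, H x -> H y -> f x = f y -> x = y)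
    \/ (exists g : nat -> nat, injective g /\ forall x, H x -> f x = g (pi1 x)) ).

Definition lexlt (a b : nat * nat) : bool :=
  (a.1 < b.1) || ((a.1 == b.1) && (a.2 < b.2)).

Definition nsubset_of (n : nat) (H : nat * nat -> Prop) (s : seq (nat * nat)) : Prop :=
  [/\ size s = n, sorted lexlt s & forall x, x \in s -> H x].

(** (n,t)-weakly Ramsey: a partition of [omega^2]^n into k pieces is a colouring
    c with values < k on n-subsets. *)
Definition weakly_ramsey (W : (nat * nat -> Prop) -> Prop) (n t : nat) : Prop :=
  forall (k : nat) (c : seq (nat * nat) -> nat),
    (forall s, nsubset_of n (fun _ => True) s -> c s < k) ->
    exists H, W H /\ exists L : seq nat, size L <= t /\
      forall s, nsubset_of n H s -> c s \in L.

(** * n-types.  Symbols: inl i = x_(i+1), inr i = y_(i+1).  A linear pre-order is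
    a total transitive boolean relation R on the symbols. *)
Definition sym (n : nat) : finType := ('I_n + 'I_n)%type.

Definition is_ntype (n : nat) (R : {ffun sym n * sym n -> bool}) : bool :=
  let le a b := R (a, b) in
  let lt a b := le a b && ~~ le b a in
  [&& [forall a, forall b, le a b || le b a],
      [forall a, forall b, forall c, le a b ==> le b c ==> le a c],
      [forall i : 'I_n, forall j : 'I_n, (i < j)%N ==> lt (inr i) (inr j)],
      [forall i : 'I_n, lt (inl i) (inr i)]
    & [forall a, forall b, ((a != b) && le a b && le b a) ==>
          (if a is inl _ then true else false) && (if b is inl _ then true else false)]].

Definition T (n : nat) : nat := #|[set R : {ffun sym n * sym n -> bool} | is_ntype R]|.

(** * Full arithmetic: a symbol for every finitary function and relation on omega. *)
Inductive term : Type :=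
| tvar : nat -> term
| tapp : forall n : nat, (('I_n -> nat) -> nat) -> ('I_n -> term) -> term.

Inductive formula : Type :=
| frel : forall n : nat, (('I_n -> nat) -> Prop) -> ('I_n -> term) -> formula
| feq : term -> term -> formula
| fnot : formula -> formula
| fand : formula -> formula -> formula
| fex : nat -> formula -> formula.

(** Ultrapower D-prod N: elements are (representatives) S -> nat, equality and
    relations interpreted modulo D as in the definition of the ultrapower. *)
Fixpoint tval (S : Type) (rho : nat -> S -> nat) (t : term) : S -> nat :=
  match t with
  | tvar i => rho i
  | tapp n F a => fun s => F (fun i => tval rho (a i) s)
  end.

Definition upd (S : Type) (rho : nat -> S -> nat) (i : nat) (g : S -> nat) :
  nat -> S -> nat := fun j => if j == i then g else rho j.

Fixpoint sat (S : Type) (D : (S -> Prop) -> Prop) (rho : nat -> S -> nat)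
    (phi : formula) : Prop :=
  match phi with
  | frel n R a => D (fun s => R (fun i => tval rho (a i) s))
  | feq t u => D (fun s => tval rho t s = tval rho u s)
  | fnot p => ~ sat D rho p
  | fand p q => sat D rho p /\ sat D rho q
  | fex i p => exists g : S -> nat, sat D (upd rho i g) p
  end.

Definition image_filter (S T' : Type) (f : S -> T') (D : (S -> Prop) -> Prop) :
  (T' -> Prop) -> Prop := fun B => D (fun s => B (f s)).

(** f is conservative on D: every set definable (formula phi, free variable 0,
    parameters rho) in D-prod N, intersected with the image of f_star ([h] |-> [h o f]),
    is definable with parameters in f(D)-prod N (transported along f_star). *)
Definition conservative_map (S T' : Type) (D : (S -> Prop) -> Prop) (f : S -> T') : Prop :=
  forall (phi : formula) (rho : nat -> S -> nat),
    exists (psi : formula) (sigma : nat -> T' -> nat),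
      forall h : T' -> nat,
        sat D (upd rho 0 (fun s => h (f s))) phi <->
        sat (image_filter f D) (upd sigma 0 h) psi.

(* Main.v *)
(** An [n]-type describes how the coordinates of the [n] points, in increasing
    order, are adjoined one at a time: each is either a new [x] or a [y] over an
    earlier [x].  A colouring of such sequences is integrated out from the last
    coordinate to the first.  For a new [x] one takes the limit along [pi1 W].  For
    a [y] over [x] there need be no ultrafilter on the section at [x], but
    conservativity yields a colouring [c'] of the shorter sequences [s] such that,
    whenever [s = S x] is a function of [x], [c (S x, y) = c' (S x)] for [W]-most
    [(x, y)].  The first [s] for which this equation fails at [(x, y)] is therefore,
    modulo [W], not a function of [x], so by the three-functions property it is a
    one-to-one function of [(x, y)] and tends to infinity.  On a set in [W] whose
    coordinates grow fast enough, the equation then holds at every adjunction,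
    and the colour depends only on the type. *)

Require Import Defs.
From mathcomp Require Import all_boot zify.
From mathcomp Require Import boolp.
Set Implicit Arguments. Unset Strict Implicit. Unset Printing Implicit Defensive.

(** * Ultrafilters and Łoś's theorem *)

Section Ultrafilters.
Variables (S : Type) (D : (S -> Prop) -> Prop).
Hypothesis ultraD : is_ultrafilter D.

Lemma ultra_mono (A B : S -> Prop) : (forall x, A x -> B x) -> D A -> D B.
Proof. by case: ultraD => _ sub _ _ AB DA; apply: sub DA AB. Qed.

Lemma ultraI (A B : S -> Prop) : D A -> D B -> D (fun x => A x /\ B x).
Proof. by case: ultraD => _ _ + _; apply. Qed.

Lemma ultra_mono2 (A B E : S -> Prop) :
  (forall x, A x -> B x -> E x) -> D A -> D B -> D E.
Proof.
by move=> ABE DA DB; apply: ultra_mono (ultraI DA DB) => x [/ABE]; apply.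
Qed.

Lemma ultraT (A : S -> Prop) : (forall x, A x) -> D A.
Proof.
by move=> allA; case: ultraD => _ _ _ /(_ A)[//|]; apply: ultra_mono => x.
Qed.

Lemma ultraN (A : S -> Prop) : ~ D A <-> D (fun x => ~ A x).
Proof.
case: ultraD => noF _ _ /(_ A) AN; split; first by case: AN.
move=> DN DA; apply: noF; apply: ultra_mono2 DA DN => x Ax; exact.
Qed.

Lemma ultra_ex (A : S -> Prop) : D A -> exists x, A x.
Proof.
move=> DA; apply: contrapT => noA; case: ultraD => noF _ _ _.
by apply: noF; apply: ultra_mono DA => x Ax; apply: noA; exists x.
Qed.

Lemma ultra_color (K : nat) (c : S -> 'I_K.+1) : exists i, D (fun x => c x = i).
Proof.
suff color_in (s : seq 'I_K.+1) : D (fun x => c x \in s) ->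
    exists i, D (fun x => c x = i).
  by apply: (color_in (enum 'I_K.+1)); apply: ultraT => x; rewrite mem_enum.
elim: s => [|i s IHs] Ds; first by case/ultra_ex: Ds.
case: (EM (D (fun x => c x = i))) => [|/ultraN Dni]; first by exists i.
by apply: IHs; apply: ultra_mono2 Ds Dni => x; rewrite inE => /orP[/eqP|].
Qed.

Lemma ultra_forall (I : finType) (A : I -> S -> Prop) :
  (forall i, D (A i)) -> D (fun x => forall i, A i x).
Proof.
move=> DA; suff Ds (s : seq I) : D (fun x => forall i, i \in s -> A i x).
  by apply: ultra_mono (Ds (enum I)) => x Ax i; apply: Ax; rewrite mem_enum.
elim: s => [|i s IHs]; first exact: ultraT.
by apply: ultra_mono2 (DA i) IHs => x Aix Asx j /predU1P[->|/Asx].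
Qed.

Lemma ultra_image (T' : Type) (f : S -> T') : is_ultrafilter (image_filter f D).
Proof.
rewrite /image_filter; split.
- by case: ultraD.
- by move=> A B DA AB; apply: ultra_mono DA => x /AB.
- by move=> A B; apply: ultraI.
- by move=> A; case: ultraD => _ _ _; apply.
Qed.

Fixpoint nat_val (e : nat -> nat) (t : term) : nat :=
  match t with
  | tvar i => e i
  | tapp _ F a => F (fun i => nat_val e (a i))
  end.

Fixpoint nat_sat (e : nat -> nat) (phi : formula) : Prop :=
  match phi with
  | Defs.frel _ R a => R (fun i => nat_val e (a i))
  | feq t u => nat_val e t = nat_val e u
  | fnot p => ~ nat_sat e p
  | fand p q => nat_sat e p /\ nat_sat e q
  | fex i p => exists m, nat_sat (fun j => if j == i then m else e j) p
  end.

Lemma tval_pointwise (rho : nat -> S -> nat) (t : term) (s : S) :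
  Defs.tval rho t s = nat_val (fun j => rho j s) t.
Proof. by elim: t => //= n F a IH; congr F; apply/funext => i; apply: IH. Qed.

Lemma Los phi : forall rho : nat -> S -> nat,
  sat D rho phi <-> D (fun s => nat_sat (fun j => rho j s) phi).
Proof.
elim: phi => [n R a|t u|p IH|p IHp q IHq|i p IH] rho /=.
- have valE s : (fun i => Defs.tval rho (a i) s) = fun i => nat_val (fun j => rho j s) (a i).
    by apply/funext => i; apply: tval_pointwise.
  by split; apply: ultra_mono => s; rewrite valE.
- by split; apply: ultra_mono => s; rewrite !tval_pointwise.
- by rewrite IH ultraN.
- rewrite IHp IHq; split=> [[]|Dpq]; first exact: ultraI.
  by split; apply: ultra_mono Dpq => s [].
have updE g s : (fun j => upd rho i g j s) = (fun j => if j == i then g s else rho j s).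
  by apply/funext => j; rewrite /upd; case: ifP.
split=> [[g /IH Dg]|Dex].
  by apply: ultra_mono Dg => s; rewrite updE; exists (g s).
(* Witnesses are chosen pointwise, with the value 0 at the [s] that have none; by [Dex] these do not
   matter modulo [D]. *)
have /choice[g gP] : forall s, exists m,
    (exists m, nat_sat (fun j => if j == i then m else rho j s) p) ->
    nat_sat (fun j => if j == i then m else rho j s) p.
  move=> s; case: (EM (exists m, nat_sat (fun j => if j == i then m else rho j s) p)).
    by case=> m satm; exists m.
  by exists 0.
by exists g; apply/IH; apply: ultra_mono Dex => s /gP; rewrite updE.
Qed.

End Ultrafilters.

(** * Coordinates and types *)

Definition coord (H : nat * nat -> Prop) (z : nat) : Prop :=
  exists2 p, H p & z = p.1 \/ z = p.2.

Lemma coord_sub (H H' : nat * nat -> Prop) z :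
  (forall p, H p -> H' p) -> coord H z -> coord H' z.
Proof. by move=> HH' [p /HH' H'p zp]; exists p. Qed.

(* Sequences are written backwards: [z :: s] lists the coordinates in decreasing
   order.  In a word, [None] stands for a new [x]-coordinate and [Some j] for a
   [y]-coordinate over the one at index [j] in the list of smaller coordinates. *)
Fixpoint instance (H : nat * nat -> Prop) (w : seq (option nat)) (s : seq nat) : Prop :=
  match w, s with
  | [::], [::] => True
  | o :: w, z :: s => [/\ instance H w s, all (ltn^~ z) s &
      if o is Some j then H (nth 0 s j, z) else exists2 p, H p & z = p.1]
  | _, _ => False
  end.

Lemma instance_size H w s : instance H w s -> size s = size w.
Proof. by elim: w s => [|o w IHw] [|z s] //= [/IHw-> _ _]. Qed.

Lemma instance_coord H o w z s : instance H (o :: w) (z :: s) -> coord H z.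
Proof.
case: o => [j|] /= [_ _]; last by case=> p Hp ->; exists p => //; left.
by move=> Hz; exists (nth 0 s j, z) => //; right.
Qed.

Lemma instance_sub (H H' : nat * nat -> Prop) w s :
  (forall p, H p -> H' p) -> instance H w s -> instance H' w s.
Proof.
move=> HH'; elim: w s => [|[j|] w IHw] [|z s] //= [/IHw ? ?].
  by move=> /HH'.
by case=> p /HH' H'p zp; split=> //; exists p.
Qed.

Section Types.
Variable n : nat.

Definition val_type (v : sym n -> nat) : {ffun sym n * sym n -> bool} :=
  [ffun ab => v ab.1 <= v ab.2].

Lemma val_type_ntype (v : sym n -> nat) :
  (forall i j : 'I_n, i < j -> v (inr i) < v (inr j)) ->
  (forall i, v (inl i) < v (inr i)) -> (forall i j, v (inl i) <> v (inr j)) ->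
  is_ntype (val_type v).
Proof.
move=> y_mono x_lt_y x_neq_y; apply/and5P; split.
- by apply/forallP => a; apply/forallP => b; rewrite !ffunE leq_total.
- apply/forallP => a; apply/forallP => b; apply/forallP => d; rewrite !ffunE.
  by apply/implyP => /= ab; apply/implyP; apply: leq_trans.
- apply/forallP => i; apply/forallP => j; apply/implyP => /y_mono ltij.
  by rewrite !ffunE /= -ltnNge ltij ltnW.
- by apply/forallP => i; rewrite !ffunE /= -ltnNge x_lt_y ltnW.
apply/forallP => a; apply/forallP => b; apply/implyP; rewrite !ffunE /= -andbA.
case/and3P=> neq_ab le_ab le_ba.
have eq_ab : v a = v b by apply/eqP; rewrite eqn_leq le_ab.
case: a b eq_ab neq_ab {le_ab le_ba} => [i|i] [j|j] //.
- by move/x_neq_y.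
- by move/esym/x_neq_y.
- by case: (ltngtP i j) => [/y_mono|/y_mono|/val_inj->];
    [move=> + eq_ij; rewrite eq_ij ltnn..|rewrite eqxx].
Qed.

(** [pick] depends only on its predicate, and equivalent symbols of a pre-order give the same
    predicate; so each class gets a single representative. *)
Definition type_rep (R : {ffun sym n * sym n -> bool}) (a : sym n) : sym n :=
  odflt a [pick b | R (a, b) && R (b, a)].

(* Listed from the largest class to the smallest, as [instance] requires. *)
Definition type_reps (R : {ffun sym n * sym n -> bool}) : seq (sym n) :=
  sort (fun a b => R (b, a)) [seq a <- enum (sym n) | type_rep R a == a].

Fixpoint type_word (R : {ffun sym n * sym n -> bool}) (r : seq (sym n)) :
    seq (option nat) :=
  if r is a :: r' then
    (if a is inr i then Some (index (type_rep R (inl i)) r') else None)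
      :: type_word R r'
  else [::].

Variable v : sym n -> nat.
Let R := val_type v.

Lemma val_type_rep a : v (type_rep R a) = v a.
Proof.
rewrite /type_rep; case: pickP => //= b.
by rewrite !ffunE /= -eqn_leq => /eqP.
Qed.

Lemma eq_type_rep a b : v a = v b -> type_rep R a = type_rep R b.
Proof.
move=> ab; rewrite /type_rep.
have -> : [pick d | R (a, d) && R (d, a)] = [pick d | R (b, d) && R (d, b)].
  by apply: eq_pick => d; rewrite !ffunE /= ab.
by case: pickP => // /(_ b); rewrite !ffunE leqnn.
Qed.

Lemma type_rep_reps a : type_rep R a \in type_reps R.
Proof.
rewrite mem_sort mem_filter mem_enum andbT.
by apply/eqP/eq_type_rep/val_type_rep.
Qed.

Lemma type_reps_decreasing : sorted gtn (map v (type_reps R)).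
Proof.
rewrite gtn_sorted_uniq_geq map_inj_in_uniq; last first.
  move=> a b; rewrite !mem_sort !mem_filter => /andP[/eqP ra _] /andP[/eqP rb _].
  by rewrite -{2}ra -{2}rb; apply: eq_type_rep.
rewrite sort_uniq filter_uniq ?enum_uniq //= sorted_map.
rewrite (@eq_sorted _ _ (fun a b => R (b, a))) => [|a b]; last by rewrite ffunE.
by apply: sort_sorted => a b; rewrite !ffunE leq_total.
Qed.

(** Given the type, the decreasing list of values determines [v]; a colouring of valuations of one
    type thus becomes a colouring of sequences. *)
Lemma nth_type_reps a :
  nth 0 (map v (type_reps R)) (index (type_rep R a) (type_reps R)) = v a.
Proof.
by rewrite (nth_map a) ?index_mem ?type_rep_reps // nth_index ?type_rep_reps ?val_type_rep.
Qed.

Lemma type_word_instance (H : nat * nat -> Prop) :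
  (forall i, H (v (inl i), v (inr i))) -> (forall i, v (inl i) < v (inr i)) ->
  instance H (type_word R (type_reps R)) (map v (type_reps R)).
Proof.
move=> Hv ltv; have := type_reps_decreasing.
(* Invariant for the induction on tails: a tail containing $y_i$ also contains the representative of
   $x_i$. Removing the head, whose value is the largest, preserves it because $x_i < y_i$. *)
have : forall i, inr i \in type_reps R -> type_rep R (inl i) \in type_reps R.
  by move=> i _; apply: type_rep_reps.
elim: (type_reps R) => //= a r IHr closed_r.
rewrite (path_sortedE (rev_trans ltn_trans)) => /andP[lt_a sorted_r].
split=> //.
  apply: IHr => // i ir; have := closed_r i; rewrite !inE ir orbT => /(_ isT).
  case/predU1P=> // ra; have /allP/(_ (v (inr i))) := lt_a.
  rewrite map_f // -ra val_type_rep => /(_ isT) /(ltn_trans (ltv i)).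
  by rewrite ltnn.
case: a lt_a closed_r => [i|i] lt_a closed_r; first by exists (v (inl i), v (inr i)).
have : type_rep R (inl i) \in r.
  have := closed_r i; rewrite !inE eqxx => /(_ isT) /predU1P[ra|//].
  by have := ltv i; rewrite -(val_type_rep (inl i)) ra ltnn.
move=> mem_r; rewrite (nth_map (inl i)) ?index_mem // nth_index //.
by rewrite val_type_rep.
Qed.

End Types.

(** On each level set of [f] in [H] the function [v] takes at most one value, and only finitely many
    levels lie below [m]. This is the sense in which [f] tends to infinity with [v]. *)
Lemma inj_on_bounded_preimage (S : Type) (H : S -> Prop) (v f : S -> nat) :
  (forall p q, H p -> H q -> f p = f q -> v p = v q) ->
  forall m, exists b, forall p, H p -> f p <= m -> v p < b.
Proof.
move=> f_inj.
have level m : exists b, forall p, H p -> f p = m -> v p < b.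
  case: (EM (exists2 p, H p & f p = m)) => [[p Hp fp]|no].
    by exists (v p).+1 => q Hq fq; rewrite (f_inj q p) ?fq.
  by exists 0 => p Hp fp; case: no; exists p.
elim=> [|m [b1 b1P]].
  by have [b bP] := level 0; exists b => p Hp; rewrite leqn0 => /eqP; apply: bP.
have [b2 b2P] := level m.+1; exists (maxn b1 b2) => p Hp.
rewrite leq_max leq_eqVlt => /orP[/eqP|]; first by move/(b2P p Hp)->; rewrite orbT.
by rewrite ltnS => /(b1P p Hp)->.
Qed.

Lemma bounded_seq_image_bounded (F : seq nat -> nat) (k z : nat) :
  exists b, forall s, size s = k -> all (leq^~ z) s -> F s <= b.
Proof.
exists (\max_(t : k.-tuple 'I_z.+1) F (map val t)) => s sz_s le_s.
have sz : size (map (@inord z) s) == k by rewrite size_map sz_s.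
have -> : s = map val (Tuple sz).
  rewrite -map_comp map_id_in // => x xs /=.
  by rewrite inordK // ltnS; apply: (allP le_s).
exact: (leq_bigmax (F := fun t : k.-tuple _ => F (map val t))).
Qed.

(** * Ultrafilters with the three-functions property *)

Section NonPPoint.
Variable W : (nat * nat -> Prop) -> Prop.
Hypotheses (ultraW : is_ultrafilter W) (stdW : non_P_point_std W).
Hypotheses (threeW : three_functions_property W) (consW : conservative_map W pi1).

(** The left side says that [h] composed with [pi1] lies in a set defined in the ultrapower by one
    atomic formula. Conservativity defines its trace over the image ultrafilter, and Łoś's theorem
    reads that definition pointwise, its parameters being absorbed into [R']. *)
Lemma conservative_relation (R : nat -> nat * nat -> Prop) :
  exists R' : nat -> nat -> Prop, forall h : nat -> nat,
    W (fun p => R (h p.1) p) <-> W (fun p => R' (h p.1) p.1).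
Proof.
(* Variable 0 is the element tested; variables 1 and 2 are parameters naming the two coordinate
   functions. *)
pose phi := @Defs.frel 3 (fun v => R (v (@Ordinal 3 0 isT))
  (v (@Ordinal 3 1 isT), v (@Ordinal 3 2 isT))) (fun i => tvar i).
pose rho i (p : nat * nat) := if i == 1 then p.1 else p.2.
have [psi [sigma psiP]] := consW phi rho.
exists (fun m x => nat_sat (fun j => if j == 0 then m else sigma j x) psi) => h.
have := psiP h; rewrite (Los (ultra_image ultraW pi1)) /= /image_filter /pi1 => hP.
have -> : (fun p => R (h p.1) p) = (fun p : nat * nat => R (h p.1) (p.1, p.2)).
  by apply/funext => -[].
rewrite hP; split; apply: ultra_mono => // p;
  by congr (nat_sat _ _); apply/funext => j; rewrite /upd; case: ifP.
Qed.

(** An index and a colour are coded by one number, so that the graph of [c] is a single relation.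
    For fixed [h] the colour is some constant [i] modulo [W], so [R'] accepts some colour almost
    everywhere. [c'] picks an accepted one, and reading the equivalence backwards for [hc] shows
    that it is the true colour. *)
Lemma conservative_color (K : nat) (c : nat -> nat * nat -> 'I_K.+1) :
  exists c' : nat -> nat -> 'I_K.+1, forall h : nat -> nat,
    W (fun p => c (h p.1) p = c' (h p.1) p.1).
Proof.
pose R m p := exists h i, m = pickle (h, i) /\ c h p = i.
have pickle_inj : injective (pickle : nat * 'I_K.+1 -> nat) := pcan_inj pickleK.
have RE h i p : R (pickle (h, i)) p <-> c h p = i.
  by split=> [[h1 [i1 [/pickle_inj[-> ->]]]]|] //; exists h, i.
have [R' R'P] := conservative_relation R.
have /choice[c' c'P] : forall hx : nat * nat, exists i : 'I_K.+1,
    (exists i : 'I_K.+1, R' (pickle (hx.1, i)) hx.2) -> R' (pickle (hx.1, i)) hx.2.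
  move=> hx; case: (EM (exists i : 'I_K.+1, R' (pickle (hx.1, i)) hx.2)).
    by case=> i R'i; exists i.
  by exists ord0.
exists (fun m x => c' (m, x)) => h.
have [i Wi] := ultra_color ultraW (fun p => c (h p.1) p).
pose hi x := pickle (h x, i); pose hc x := pickle (h x, c' (h x, x)).
have /(R'P hi) Wi' : W (fun p => R (hi p.1) p) by apply: (ultra_mono ultraW) Wi => p /RE.
have /(R'P hc) : W (fun p => R' (hc p.1) p.1).
  by apply: (ultra_mono ultraW) Wi' => p R'i; apply: (c'P (_, _)); exists i.
by apply: (ultra_mono ultraW) => p /RE.
Qed.

(** * Injectivity and sparseness of coordinates on sets in $\mathcal W$ *)

Lemma not_bounded_sections (H : nat * nat -> Prop) :
  (forall m, exists b, forall p, H p -> p.1 = m -> p.2 < b) -> ~ W H.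
Proof.
move=> bounded /stdW[_]; apply=> m; have [b bP] := bounded m.
exists [seq (m, y) | y <- iota 0 b] => -[x y] Hp /= x_m.
by rewrite -x_m; apply: map_f; rewrite mem_iota (bP _ Hp).
Qed.

Lemma not_snd_le_fst (g : nat -> nat) : ~ W (fun p => p.2 <= g p.1).
Proof.
by apply: not_bounded_sections => m; exists (g m).+1 => p + <-; rewrite ltnS.
Qed.

Lemma not_fst_eq (m : nat) : ~ W (fun p => p.1 = m).
Proof. by move=> /stdW[cst _]; apply: cst; exists m. Qed.

Lemma not_fst_lt (b : nat) : ~ W (fun p => p.1 < b).
Proof.
elim: b => [|b IHb]; first by move/(ultra_ex ultraW)=> [].
move=> Wb; apply: IHb; have /(ultraN ultraW) := not_fst_eq (m := b).
by apply: (ultra_mono2 ultraW) Wb => p; rewrite ltnS leq_eqVlt => /orP[/eqP|].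
Qed.

Lemma inj_on_fst (f : nat -> nat) : (forall c, ~ W (fun p => f p.1 = c)) ->
  exists2 H, W H & forall p q, H p -> H q -> f p.1 = f q.1 -> p.1 = q.1.
Proof.
move=> ncst; have [H [WH]] := threeW (fun p => f p.1); case=> [[c cP]|[inj|[g [ginj gP]]]].
- by case: (ncst c); apply: (ultra_mono ultraW) WH.
- exists H => // p q Hp Hq fpq; by rewrite (inj p q).
- by exists H => // p q Hp Hq; rewrite (gP p) // (gP q) // => /ginj.
Qed.

Lemma inj_on_point (f : nat * nat -> nat) : (forall g : nat -> nat, ~ W (fun p => f p = g p.1)) ->
  exists2 H, W H & forall p q, H p -> H q -> f p = f q -> p = q.
Proof.
move=> nfst; have [H [WH]] := threeW f; case=> [[c cP]|[inj|[g [ginj gP]]]].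
- by case: (nfst (fun=> c)); apply: (ultra_mono ultraW) WH.
- by exists H.
- by case: (nfst g); apply: (ultra_mono ultraW) WH.
Qed.

(* Otherwise [F o pi1] and [F o pi2] would have the same image ultrafilter,
   although every function on the first image is constant or one-to-one,
   while on the second image the function recovering [x] from [F y] is neither. *)
Lemma images_differ (F : nat -> nat) (H0 : nat * nat -> Prop) :
  W H0 -> (forall p q, H0 p -> H0 q -> F p.2 = F q.2 -> p = q) ->
  exists B : nat -> Prop, W (fun p => B (F p.1)) /\ W (fun p => ~ B (F p.2)).
Proof.
move=> WH0 F2inj; apply: contrapT => same.
have transfer (B : nat -> Prop) : W (fun p => B (F p.1)) -> W (fun p => B (F p.2)).
  by move=> WB; apply: contrapT => /(ultraN ultraW) WnB; apply: same; exists B.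
have /choice[G GP] : forall v, exists x, forall p, H0 p -> F p.2 = v -> x = p.1.
  move=> v; case: (EM (exists2 p, H0 p & F p.2 = v)) => [[p Hp Fp]|no].
    by exists p.1 => q Hq Fq; rewrite (F2inj p q) ?Fp ?Fq.
  by exists 0 => p Hp Fp; case: no; exists p.
have GF p : H0 p -> G (F p.2) = p.1 by move=> Hp; apply: GP Hp _.
have [|H1 WH1 GFinj] := @inj_on_fst (fun x => G (F x)).
  move=> c /(transfer (fun v => G v = c)) WGc; apply: (not_fst_eq (m := c)).
  by apply: (ultra_mono2 ultraW) WGc WH0 => p Gc /GF <-.
have W2 : W (fun p => exists2 q, H1 q & F p.2 = F q.1).
  apply: (transfer (fun v => exists2 q, H1 q & v = F q.1)).
  by apply: (ultra_mono ultraW) WH1 => p; exists p.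
(* Each section of [H2] has at most one point: [G] sends [F p.2] to [p.1], and it is one-to-one on
   the values [F q.1] with [q] in [H1], so [p.1] determines [F p.2] and hence [p]. *)
pose H2 p := H0 p /\ exists2 q, H1 q & F p.2 = F q.1.
apply: (@not_bounded_sections H2) (ultraI ultraW WH0 W2) => m.
case: (EM (exists2 p, H2 p & p.1 = m)) => [[p [Hp [q Hq Fpq]] pm]|no]; last first.
  by exists 0 => p Hp pm; case: no; exists p.
exists p.2.+1 => p' [Hp' [q' Hq' Fpq']] pm'.
suff -> : p' = p by [].
apply: F2inj => //; rewrite Fpq Fpq'; congr F; apply: GFinj => //.
by rewrite -Fpq -Fpq' !GF ?pm ?pm'.
Qed.

(** A finite-to-one [F] is not constant on first coordinates, nor at second coordinates a function
    of the first, so the three-functions property makes it one-to-one on each kind. The set from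
    [images_differ] separates the two kinds from each other. *)
Lemma inj_on_coord (F : nat -> nat) :
  (forall c, exists b, forall z, F z = c -> z < b) ->
  exists2 H, W H & [/\ forall p q, H p -> H q -> F p.2 = F q.2 -> p = q,
                      forall p q, H p -> H q -> F p.1 <> F q.2 &
                      forall z z', coord H z -> coord H z' -> F z = F z' -> z = z'].
Proof.
move=> /choice[b bP].
have [|H1 WH1 H1P] := @inj_on_fst F.
  move=> c Wc; apply: (@not_fst_lt (b c)).
  by apply: (ultra_mono ultraW) Wc => p /bP.
have [|H2 WH2 H2P] := @inj_on_point (fun p => F p.2).
  move=> g Wg; apply: (@not_snd_le_fst (fun x => b (g x))).
  by apply: (ultra_mono ultraW) Wg => p /bP/ltnW.
have [B [WB1 WB2]] := images_differ WH2 H2P.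
exists (fun p => (H1 p /\ H2 p) /\ (B (F p.1) /\ ~ B (F p.2))).
  by do !apply: (ultraI ultraW).
split=> [p q [[_ ?] _] [[_ ?] _]|p q [_ [Bp _]] [_ [_ nBq]] Fpq|]; first exact: H2P.
  by rewrite -Fpq in nBq.
move=> z z' [p [[H1p H2p] [Bp nBp]] zp] [q [[H1q H2q] [Bq nBq]] zq].
case: zp zq => -> [] -> Fpq.
- exact: H1P.
- by rewrite -Fpq in nBq.
- by rewrite Fpq in nBp.
- by rewrite (H2P p q).
Qed.

(* The naturals are cut into intervals so long that [phi] maps each one below
   the end of the next one; coordinates are then kept in nonadjacent intervals. *)
Lemma sparse_coord (phi : nat -> nat) :
  exists2 H, W H & forall z z', coord H z -> coord H z' -> z < z' -> phi z < z'.
Proof.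
(* [step m] exceeds [m] and every [phi z] with [z < m]. *)
pose step m := (m + \sum_(z < m) phi z).+1.
pose e k := iter k step 0.
have e_lt k : e k < e k.+1 by rewrite /= /step ltnS leq_addr.
have e_mono : {homo e : i j / i <= j}.
  by apply: homo_leq => // [|i]; [exact: leq_trans | exact: ltnW].
have e_ge k : k <= e k by elim: k => // k IHk; apply: leq_ltn_trans (e_lt k).
have e_phi k z : z < e k -> phi z < e k.+1.
  move=> zk; rewrite /= /step ltnS; apply: leq_trans (leq_addl _ _).
  by rewrite (bigD1 (Ordinal zk)) //= leq_addr.
have exI z : exists k, z < e k by exists z.+1.
pose I z := ex_minn (exI z).
have I_lt z : z < e (I z) by rewrite /I; case: ex_minnP.
have I_min z k : z < e k -> I z <= k.
  by rewrite /I; case: ex_minnP => m _ mP /mP.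
have I_fin F : (forall k, k <= (F k).*2.+1) ->
    forall c, exists b, forall z, F (I z) = c -> z < b.
  move=> F_ge c; exists (e c.*2.+1) => z <-; apply: leq_trans (I_lt z) _.
  exact: e_mono.
(* The two halvings merge interval $2k$ with $2k+1$ and $2k-1$ with $2k$. Injectivity of both
   forbids equal and adjacent intervals for distinct coordinates. *)
have [|H1 WH1 [_ _ H1P]] := @inj_on_coord (fun z => (I z)./2).
  by apply: (I_fin half) => k; lia.
have [|H2 WH2 [_ _ H2P]] := @inj_on_coord (fun z => (I z).+1./2).
  by apply: (I_fin (fun k => k.+1./2)) => k; lia.
exists (fun p => H1 p /\ H2 p); first exact: (ultraI ultraW).
move=> z z' Hz Hz' zz'.
have ne1 : (I z)./2 <> (I z')./2.
  move=> /H1P eq_zz'; move: zz'; rewrite eq_zz' ?ltnn //;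
    by [apply: coord_sub Hz => p [] | apply: coord_sub Hz' => p []].
have ne2 : (I z).+1./2 <> (I z').+1./2.
  move=> /H2P eq_zz'; move: zz'; rewrite eq_zz' ?ltnn //;
    by [apply: coord_sub Hz => p [] | apply: coord_sub Hz' => p []].
have leI : I z <= I z' by apply/I_min/(ltn_trans zz')/I_lt.
apply: leq_trans (e_phi _ _ (I_lt z)) _.
by case: (leqP (e (I z).+1) z') => // /I_min; lia.
Qed.

(** If [f p <= psi z], then [v p < b (psi z)] for a bound [b]; but [v p] is a coordinate above [z],
    and sparseness puts it beyond [b (psi z)]. *)
Lemma diagonal (v f : nat * nat -> nat) (H0 : nat * nat -> Prop) :
  (forall p, v p = p.1 \/ v p = p.2) -> W H0 ->
  (forall p q, H0 p -> H0 q -> f p = f q -> v p = v q) ->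
  forall psi : nat -> nat, exists2 H, W H &
    forall p z, H p -> coord H z -> z < v p -> psi z < f p.
Proof.
move=> vP WH0 /inj_on_bounded_preimage/choice[b bP] psi.
have [H1 WH1 H1P] := sparse_coord (fun z => b (psi z)).
exists (fun p => H0 p /\ H1 p); first exact: (ultraI ultraW).
move=> p z [H0p H1p] Hz zp; rewrite ltnNge; apply/negP => /(bP _ p H0p).
apply/negP; rewrite -leqNgt ltnW //; apply: H1P => //.
  by apply: coord_sub Hz => q [].
by exists p.
Qed.

(** The search for a failure is cut off at [v p], which makes [f] total. The cutoff is harmless
    below, where [v] is itself a coordinate: $x$ is not constant and $y$ is not a function of $x$
    modulo $\mathcal W$. *)
Lemma first_failure (S : Type) (A : nat -> S -> Prop) (v : S -> nat) :
  exists f : S -> nat, forall p,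
    (~ A (f p) p \/ f p = v p) /\ (forall m, m < f p -> A m p).
Proof.
suff /choice[f fP] : forall p, exists m,
    (~ A m p \/ m = v p) /\ (forall m', m' < m -> A m' p) by exists f.
move=> p; have ex : exists m, `[< ~ A m p >] || (m == v p) by exists (v p); rewrite eqxx orbT.
exists (ex_minn ex); case: ex_minnP => m /orP[/asboolP nA|/eqP->] minm;
  (split; first by [left|right]) => m' ltm'; apply: contrapT => nA';
  by have := minm m'; rewrite asboolT //= leqNgt ltm' => /(_ isT).
Qed.

(** Since [A c] holds almost everywhere, [f = c] would force [x = c] there. So the first failure [f]
    is not constant modulo [W], and [inj_on_fst] and [diagonal] apply. *)
Lemma diagonal_fst (A : nat -> nat -> Prop) :
  (forall m, W (fun p => A m p.1)) -> forall psi : nat -> nat, exists2 H, W H &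
    forall p z, H p -> coord H z -> z < p.1 -> forall m, m <= psi z -> A m p.1.
Proof.
move=> WA psi; have [f fP] := first_failure A id.
have [|H0 WH0 H0P] := @inj_on_fst f.
  move=> c Wc; apply: (not_fst_eq (m := c)).
  apply: (ultra_mono2 ultraW) (WA c) Wc => p Ac fc.
  by case: (fP p.1) => -[nA|fp] _; [case: nA; rewrite fc | rewrite -fc fp].
have [|H WH HP] := @diagonal fst (fun p => f p.1) H0 _ WH0 H0P psi; first by left.
exists H => // p z Hp Hz zp m mz; apply: (proj2 (fP p.1)).
by apply: leq_ltn_trans mz (HP _ _ _ _ _).
Qed.

(** If the first failure were $g(x)$ modulo [W], the hypothesis for [g] would leave only the cutoff
    $y = g(x)$, which [not_snd_le_fst] excludes. *)
Lemma diagonal_snd (A : nat -> nat * nat -> Prop) :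
  (forall h : nat -> nat, W (fun p => A (h p.1) p)) ->
  forall psi : nat -> nat, exists2 H, W H &
    forall p z, H p -> coord H z -> z < p.2 -> forall m, m <= psi z -> A m p.
Proof.
move=> WA psi; have [f fP] := first_failure A snd.
have [|H0 WH0 H0P] := @inj_on_point f.
  move=> g Wg; apply: (@not_snd_le_fst g).
  apply: (ultra_mono2 ultraW) (WA g) Wg => p Ag fg.
  by case: (fP p) => -[nA|fp] _; [case: nA; rewrite fg | rewrite -fg fp].
have [||H WH HP] := @diagonal snd f H0 _ WH0 _ psi; first by right.
  by move=> p q Hp Hq /H0P ->.
exists H => // p z Hp Hz zp m mz; apply: (proj2 (fP p)).
by apply: leq_ltn_trans mz (HP _ _ _ _ _).
Qed.

(** * Homogeneous sets for words and types *)

Lemma instance_homogeneous (K : nat) (w : seq (option nat)) :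
  forall c : seq nat -> 'I_K.+1, exists (H : nat * nat -> Prop) i,
    W H /\ forall s, instance H w s -> c s = i.
Proof.
elim: w => [|o w IHw] c.
  by exists (fun=> True), (c [::]); split; [apply: (ultraT ultraW) | case].
suff [c' [H0 [WH0 H0P]]] : exists c' : seq nat -> 'I_K.+1, exists H0, W H0 /\
    forall z s, instance H0 (o :: w) (z :: s) -> c (z :: s) = c' s.
  have [H1 [i [WH1 H1P]]] := IHw c'.
  exists (fun p => H0 p /\ H1 p), i; split; first exact: (ultraI ultraW).
  move=> [//|z s] inst; rewrite (H0P z s); last by apply: instance_sub inst => p [].
  by case: inst => + _ _; move/instance_sub => inst; apply/H1P/inst => p [].
(* [psi y] bounds the codes of all sequences of the given length with largest entry [y]. The
   diagonal lemmas, applied to the head [y] of [s], therefore cover the code of [s]. *)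
have /choice[psi psiP] : forall z, exists b, forall s : seq nat, size s = size w ->
    all (leq^~ z) s -> pickle s <= b.
  by move=> z; apply: bounded_seq_image_bounded.
have code_le H y s : instance H w (y :: s) -> pickle (y :: s) <= psi y.
  move=> inst; apply: psiP; first exact: instance_size inst.
  case: w inst {IHw} => // o' w' [_ lt_s _] /=; rewrite leqnn.
  by apply: sub_all lt_s => x /ltnW.
have pickle_inj : injective (pickle : seq nat -> nat) := pcan_inj pickleK.
case: o => [j|].
  pose dec m : seq nat := odflt [::] (unpickle m).
  have decK : cancel pickle dec by move=> s; rewrite /dec pickleK.
  have [c' c'P] := conservative_color (fun m p => c (p.2 :: dec m)).
  pose A m p := nth 0 (dec m) j = p.1 -> c (p.2 :: dec m) = c' m p.1.
  have WA h : W (fun p => A (h p.1) p).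
    by apply: (ultra_mono ultraW) (c'P h) => p + _.
  have [H WH HP] := diagonal_snd WA psi.
  exists (fun s => c' (pickle s) (nth 0 s j)).
  (* The empty sequence has no head to bound its code, so its equation is imposed separately. *)
  exists (fun p => H p /\ A (pickle (@nil nat)) p).
  split=> [|z s]; first by apply: (ultraI ultraW) WH (WA (fun=> _)).
  case=> inst lt_s [Hz Anil].
  suff : A (pickle s) (nth 0 s j, z) by rewrite /A decK; apply.
  case: s inst lt_s Hz Anil => // y s inst /andP[ltyz _] Hz _.
  apply: (HP _ y) => //; last exact: code_le inst.
  case: w inst {IHw psiP code_le} => // o' w' inst.
  by apply: coord_sub (instance_coord inst) => p [].
have /choice[c' c'P] : forall s, exists i, W (fun p => c (p.1 :: s) = i).
  by move=> s; apply: ultra_color.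
pose A m x := forall s, pickle s = m -> c (x :: s) = c' s.
have WA m : W (fun p => A m p.1).
  case: (EM (exists s : seq nat, pickle s = m)) => [[s sm]|no].
    apply: (ultra_mono ultraW) (c'P s) => p cp s'; rewrite -sm => /pickle_inj ->.
    exact: cp.
  by apply: (ultraT ultraW) => p s sm; case: no; exists s.
have [H WH HP] := diagonal_fst WA psi.
exists c', (fun p => H p /\ A (pickle (@nil nat)) p.1).
split=> [|z s]; first by apply: (ultraI ultraW) WH (WA _).
case=> inst lt_s [p [Hp Anil] zp]; rewrite zp.
suff : A (pickle s) p.1 by apply.
case: s inst lt_s => // y s inst /andP[ltyz _].
apply: (HP _ y) => //; last exact: code_le inst.
  case: w inst {IHw psiP code_le} => // o' w' inst.
  by apply: coord_sub (instance_coord inst) => q [].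
by rewrite -zp.
Qed.

Lemma type_homogeneous (n K : nat) (c : (sym n -> nat) -> 'I_K.+1)
    (R : {ffun sym n * sym n -> bool}) :
  exists (H : nat * nat -> Prop) i, W H /\ forall v : sym n -> nat,
    (forall i, H (v (inl i), v (inr i))) -> (forall i, v (inl i) < v (inr i)) ->
    val_type v = R -> c v = i.
Proof.
have [H [i [WH HP]]] := instance_homogeneous (type_word R (type_reps R))
  (fun z => c (fun a => nth 0 z (index (type_rep R a) (type_reps R)))).
exists H, i; split=> // v Hv ltv Rv.
rewrite -(HP (map v (type_reps R))); last by rewrite -Rv; apply: type_word_instance.
by congr c; apply/funext => a; rewrite -Rv nth_type_reps.
Qed.

End NonPPoint.

(** * Lexicographic sorting and the colouring of $n$-subsets *)

Definition lexle (a b : nat * nat) : bool := ~~ lexlt b a.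

Lemma lexle_total : total lexle.
Proof. by move=> [a1 a2] [b1 b2]; rewrite /lexle /lexlt /=; lia. Qed.

Lemma lexle_trans : transitive lexle.
Proof. by move=> [a1 a2] [b1 b2] [d1 d2]; rewrite /lexle /lexlt /=; lia. Qed.

Lemma lexle_anti : antisymmetric lexle.
Proof. by move=> [a1 a2] [b1 b2]; rewrite /lexle /lexlt /= => ab; congr pair; lia. Qed.

Lemma lexltW a b : lexlt a b -> lexle a b.
Proof. by case: a b => [a1 a2] [b1 b2]; rewrite /lexle /lexlt /=; lia. Qed.

(** Types list the points by increasing $y$, while the colouring takes them in lexicographic order;
    this passes from the first order back to the second. *)
Lemma sort_lexle (s p : seq (nat * nat)) :
  sorted lexlt s -> perm_eq p s -> sort lexle p = s.
Proof.
move=> sorted_s /(perm_sortP lexle_total lexle_trans lexle_anti) ->.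
exact/(sorted_sort lexle_trans)/(sub_sorted lexltW).
Qed.

Lemma sorted_lexlt_uniq (s : seq (nat * nat)) : sorted lexlt s -> uniq s.
Proof.
apply: sorted_uniq; last by move=> [a1 a2]; rewrite /lexlt /=; lia.
by move=> [a1 a2] [b1 b2] [d1 d2]; rewrite /lexlt /=; lia.
Qed.

Definition seq_val (n : nat) (p : seq (nat * nat)) (a : sym n) : nat :=
  match a with inl i => (nth (0, 0) p i).1 | inr i => (nth (0, 0) p i).2 end.

Lemma seq_valK (n : nat) (p : seq (nat * nat)) : size p = n ->
  [seq (@seq_val n p (inl i), @seq_val n p (inr i)) | i <- enum 'I_n] = p.
Proof.
move=> sz_p; rewrite -[RHS](mkseq_nth (0, 0)) /mkseq sz_p -val_enum_ord -map_comp.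
by apply: eq_map => i /=; case: (nth _ _ _).
Qed.

Theorem mainTheorem8 (W : (nat * nat -> Prop) -> Prop) :
  is_ultrafilter W -> nonprincipal W -> non_P_point_std W ->
  three_functions_property W -> conservative_map W pi1 ->
  forall n : nat, (1 <= n)%N -> weakly_ramsey W n (T n).
Proof.
move=> ultraW _ stdW threeW consW n _ k c c_lt.
(* [c] is bounded only on lexicographically increasing sequences, hence the sorting; the successor
   gives [inord] a nonempty range. *)
pose c' (v : sym n -> nat) : 'I_k.+1 :=
  inord (c (sort lexle [seq (v (inl i), v (inr i)) | i <- enum 'I_n])).
have /choice[H /choice[col HP]] := type_homogeneous ultraW stdW threeW consW c'.
(* With the identity for [F], distinct points have distinct second coordinates and no first
   coordinate equals a second one, as an $n$-type requires. *)
have [|H0 WH0 [inj2 disj _]] := inj_on_coord ultraW stdW threeW (F := id).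
  by move=> m; exists m.+1 => z ->.
have /(ultraN ultraW) Wlt := not_snd_le_fst stdW (g := id).
exists (fun p => (H0 p /\ ~ p.2 <= p.1) /\ forall R, H R p); split.
  apply: (ultraI ultraW); first exact: (ultraI ultraW).
  by apply: (ultra_forall ultraW) => R; case: (HP R).
(* One colour for each type, hence at most $T(n)$ colours. *)
exists [seq val (col R) | R in [set R | is_ntype R]].
split=> [|s [sz_s sorted_s Hs]]; first by rewrite size_map -cardE.
pose p := sort (relpre snd leq) s.
have perm_p : perm_eq p s by rewrite perm_sort.
have sz_p : size p = n by rewrite size_sort.
have Hp (i : 'I_n) : nth (0, 0) p i \in s.
  by rewrite -(perm_mem perm_p) mem_nth // sz_p.
have sorted_p : sorted ltn (map snd p).
  rewrite ltn_sorted_uniq_leq sorted_map sort_sorted ?andbT; last first.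
    by move=> x y; apply: leq_total.
  rewrite map_inj_in_uniq ?(perm_uniq perm_p) ?sorted_lexlt_uniq //.
  move=> x y; rewrite !(perm_mem perm_p) => /Hs[[H0x _] _] /Hs[[H0y _] _].
  exact: inj2.
pose v := @seq_val n p.
have v_pair i : (v (inl i), v (inr i)) = nth (0, 0) p i.
  by rewrite /v /=; case: (nth _ _ _).
have ntype_v : is_ntype (val_type v).
  apply: val_type_ntype => [i j ltij|i|i j].
  - have := sorted_ltn_nth ltn_trans 0 sorted_p i j.
    rewrite !inE size_map sz_p !ltn_ord => /(_ isT isT ltij).
    by rewrite !(nth_map (0, 0)) ?sz_p.
  - by have [[_ /negP]] := Hs _ (Hp i); rewrite -ltnNge.
  - have [[H0i _] _] := Hs _ (Hp i); have [[H0j _] _] := Hs _ (Hp j).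
    exact: disj H0i H0j.
apply/mapP; exists (val_type v); first by rewrite mem_enum inE.
have [_ /(_ v) <-] := HP (val_type v); last by [].
- rewrite /c' seq_valK // (sort_lexle sorted_s perm_p) /= inordK // ltnS ltnW //.
  by apply: c_lt; split.
- by move=> i; rewrite v_pair; have [_] := Hs _ (Hp i).
- by move=> i; have [[_ /negP]] := Hs _ (Hp i); rewrite -ltnNge.
Qed.
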